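(* Let $(X_1,Y_1),\dots,(X_n,Y_n)\in\mathbb{R}^{d}\times\{-1,1\}$ be given data with empirical distribution $P_n=\frac1n\sum_{i=1}^n\delta_{(X_i,Y_i)}$, let $G_1,\dots,G_{\bar d}$ be a partition of $\{1,\dots,d\}$ into non-empty sets, let $q,t\in[1,\infty]$ and let $\alpha=(\alpha_1,\dots,\alpha_{\bar d})^T$ with all $\alpha_i>0$. Let $p,s$ satisfy $1/p+1/q=1$ and $1/s+1/t=1$. Let the cost function be $$c\big((x,y),(x',y')\big)=\begin{cases}\|x-x'\|_{\alpha^{-1}\text{-}(q,t)} & \text{if } y=y',\\ \infty & \text{if } y\neq y',\end{cases}$$ and let $l(x,y;\beta)=\log\big(1+\exp(-y\beta^Tx)\big)$. Then for every $\delta>0$, $$\min_{\beta\in\mathbb{R}^d}\ \sup_{P:\,\mathcal{D}_c(P,P_n)\le\delta}\mathbb{E}_P[l(X,Y;\beta)]=\min_{\beta\in\mathbb{R}^d}\Big\{\mathbb{E}_{P_n}[l(X,Y;\beta)]+\delta\,\|\beta\|_{\alpha\text{-}(p,s)}\Big\}.$$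
   Context: Vectors are column vectors. For $x\in\mathbb{R}^d$ and $G\subseteq\{1,\dots,d\}$, $x(G)$ denotes the sub-vector of $x$ with coordinates indexed by $G$. For $p,s\ge1$ and $\alpha\in\mathbb{R}^{\bar d}$ with positive entries, $$\|x\|_{\alpha\text{-}(p,s)}=\Big(\sum_{i=1}^{\bar d}\alpha_i^{s}\|x(G_i)\|_p^{s}\Big)^{1/s},$$ where $\|\cdot\|_p$ is the usual $\ell_p$ norm; when $s=\infty$ this is $\max_i \alpha_i\|x(G_i)\|_p$. Also $\alpha^{-1}=(\alpha_1^{-1},\dots,\alpha_{\bar d}^{-1})^T$. For a lower semicontinuous $c:\mathbb{R}^{d+1}\times\mathbb{R}^{d+1}\to[0,\infty]$ with $c(u,w)=0$ iff $u=w$, and probability distributions $P,Q$ on $\mathbb{R}^{d+1}$ with supports $\mathcal{S}_P,\mathcal{S}_Q$, the optimal transport discrepancy is $$\mathcal{D}_c(P,Q)=\inf\{\mathbb{E}_\pi[c(U,W)]:\ \pi \text{ a probability distribution on } \mathcal{S}_P\times\mathcal{S}_Q,\ \pi_U=P,\ \pi_W=Q\},$$ where $\pi_U,\pi_W$ are the marginals of $U$ and $W$ under $\pi$. The supremum is over probability distributions $P$ on $\mathbb{R}^{d+1}$, and $\mathbb{E}_P$ is expectation when $(X,Y)\sim P$. *)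

(* Defs.v *)
From HB Require Import structures.
From mathcomp Require Export all_boot all_order all_algebra.
From mathcomp Require Export all_classical all_reals all_analysis.
Export numFieldNormedType.Exports.
Set Implicit Arguments.
Unset Strict Implicit.
Unset Printing Implicit Defensive.
Import Order.TTheory GRing.Theory Num.Theory.
Local Open Scope classical_set_scope.
Local Open Scope ring_scope.

(* Exponents are extended reals, so that p = +oo is allowed. The branch -oo is
   a junk value. *)
Definition lp_norm (R : realType) (m : nat) (p : \bar R) (x : 'cV[R]_m) : R :=
  match p with
  | r%:E%E => (\sum_(j < m) `|x j 0| `^ r) `^ r^-1
  | +oo%E => \big[Num.max/0]_(j < m) `|x j 0|
  | -oo%E => 0
  end.

Definition subvec (R : realType) (d : nat) (x : 'cV[R]_d) (G : {set 'I_d}) :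
    'cV[R]_#|G| :=
  \col_(k < #|G|) x (enum_val k) 0.

(* The norm of x for the weights alpha and the exponents (p, s): l_p inside
   each group, weighted l_s across the groups. *)
Definition group_norm (R : realType) (d D : nat) (G : 'I_D -> {set 'I_d})
    (alpha : 'cV[R]_D) (p s : \bar R) (x : 'cV[R]_d) : R :=
  match s with
  | r%:E%E =>
      (\sum_(i < D) alpha i 0 `^ r * lp_norm p (subvec x (G i)) `^ r) `^ r^-1
  | +oo%E => \big[Num.max/0]_(i < D) (alpha i 0 * lp_norm p (subvec x (G i)))
  | -oo%E => 0
  end.

Definition is_group_partition (d D : nat) (G : 'I_D -> {set 'I_d}) : Prop :=
  [/\ forall i, G i != finset.set0,
      forall i j, i != j -> (G i :&: G j)%SET = finset.set0
    & forall k, exists i, k \in G i].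

Definition borel (T : ptopologicalType) := g_sigma_algebraType (@open T).

Definition support (R : realType) (T : ptopologicalType)
    (P : probability (borel T) R) : set (borel T) :=
  [set x : T | forall V : set T, open V -> V x -> (0 < P V)%E].

(* A probability on S_P x S_Q is represented as a probability on T x T giving
   mass 1 to S_P x S_Q. The marginals are compared on measurable sets only,
   since the values of a measure on other sets carry no information. *)
Definition couplings (R : realType) (T : ptopologicalType)
    (P Q : probability (borel T) R) : set (probability (borel T * borel T)%type R) :=
  [set pi | [/\ pi (support P `*` support Q) = 1%E,
      forall A, measurable A -> pushforward pi fst A = P A
    & forall A, measurable A -> pushforward pi snd A = Q A]].

Definition ot_discrepancy (R : realType) (T : ptopologicalType)
    (c : T -> T -> \bar R) (P Q : probability (borel T) R) : \bar R :=
  ereal_inf [set (\int[pi]_z c z.1 z.2)%E | pi in couplings P Q].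

Definition empirical (R : realType) (disp : measure_display)
    (T : measurableType disp) (n : nat) (z : 'I_n.+1 -> T) : set T -> \bar R :=
  fun A => ((n.+1%:R^-1)%:E * \sum_(i < n.+1) \d_(z i) A)%E.

Section empirical_probability.
Context (R : realType) (disp : measure_display) (T : measurableType disp).
Context (n : nat) (z : 'I_n.+1 -> T).

Let mu : {measure set T -> \bar R} :=
  mscale (n.+1%:R^-1)%:nng (msum (fun i : nat => \d_(z (inord i))) n.+1).

Let empiricalE : @empirical R disp T n z = mu.
Proof.
apply/funext => A; rewrite /mu /= /mscale /msum /empirical /=; congr (_ * _)%E.
by apply: eq_bigr => i _; rewrite inord_val.
Qed.

Let empirical0 : @empirical R disp T n z set0 = 0%E.
Proof. by rewrite empiricalE measure0. Qed.

Let empirical_ge0 A : (0 <= @empirical R disp T n z A)%E.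
Proof. by rewrite empiricalE. Qed.

Let empirical_sigma_additive : semi_sigma_additive (@empirical R disp T n z).
Proof. by rewrite empiricalE; exact: measure_semi_sigma_additive. Qed.

HB.instance Definition _ := isMeasure.Build _ _ _ (@empirical R disp T n z)
  empirical0 empirical_ge0 empirical_sigma_additive.

Let empirical_setT : @empirical R disp T n z setT = 1%E.
Proof.
rewrite /empirical (eq_bigr (fun=> 1%E)); last by move=> i _; rewrite diracT.
by rewrite sumEFin -EFinM sumr_const card_ord mulVf.
Qed.

HB.instance Definition _ :=
  Measure_isProbability.Build _ _ _ (@empirical R disp T n z) empirical_setT.

End empirical_probability.

(* R^(d+1), with points (x, y) and the product topology. *)
Definition data_space (R : realType) (d : nat) := ('cV[R]_d * R^o)%type.

HB.instance Definition _ (R : realType) (d : nat) :=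
  Topological.on (data_space R d).
HB.instance Definition _ (R : realType) (d : nat) :=
  Pointed.on (data_space R d).

Definition transport_cost (R : realType) (d D : nat) (G : 'I_D -> {set 'I_d})
    (alpha : 'cV[R]_D) (q t : \bar R) (u w : data_space R d) : \bar R :=
  if u.2 == w.2
  then (group_norm G (\col_i (alpha i 0)^-1) q t (u.1 - w.1))%:E
  else +oo%E.

Definition logistic_loss (R : realType) (d : nat) (beta : 'cV[R]_d)
    (u : data_space R d) : R :=
  ln (1 + expR (- u.2 * (beta^T *m u.1) 0 0)).

(* m is the minimum of A; in particular it is attained. *)
Definition is_min (R : realType) (A : set (\bar R)) (m : \bar R) : Prop :=
  A m /\ lbound A m.

(* Main.v *)
(* For every beta the two objectives coincide. By Hoelder's inequality applied
   within the groups and then across them, the norms alpha-(p,s) and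
   alpha^-1-(q,t) are dual, so the loss is Lipschitz in x with constant
   ||beta||_{alpha-(p,s)}; integrating along a coupling of cost close to delta
   bounds the worst case from above. Conversely the logistic loss is
   asymptotically linear, so transporting a vanishing mass of one data point
   very far in the direction attaining the dual norm gains
   delta * ||beta||_{alpha-(p,s)} in the limit. The common objective is
   continuous and coercive, hence its minimum is attained. *)
Require Import Defs.
From mathcomp Require Import measurable_realfun ring lra zify.
Set Implicit Arguments.
Unset Strict Implicit.
Unset Printing Implicit Defensive.
Import Order.TTheory GRing.Theory Num.Theory.
Local Open Scope classical_set_scope.
Local Open Scope ring_scope.

(** * Finite l_p norms and their duality *)

(** Indexing by a subset of a finite type lets one theory serve both the coordinates inside a group
    and the groups among themselves. *)
Definition lp_on (R : realType) (I : finType) (A : {set I}) (p : \bar R)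
    (x : I -> R) : R :=
  match p with
  | r%:E%E => (\sum_(j in A) `|x j| `^ r) `^ r^-1
  | +oo%E => \big[Num.max/0]_(j in A) `|x j|
  | -oo%E => 0
  end.

Section bigmax_norm.
Context (R : realType) (I : finType) (A : {set I}).
Implicit Types (x y : I -> R).

Lemma le_bigmax_norm x j : j \in A -> `|x j| <= \big[Num.max/0]_(j in A) `|x j|.
Proof. exact: (@le_bigmax_cond _ R I 0 j (mem A) (fun j => `|x j|)). Qed.

Lemma bigmax_norm_le x (c : R) : 0 <= c -> (forall j, j \in A -> `|x j| <= c) ->
  \big[Num.max/0]_(j in A) `|x j| <= c.
Proof.
move=> c0 xc.
exact: (@bigmax_le _ R I _ (fun j => `|x j|) 0 c (mem A)).
Qed.

Lemma bigmax_norm_ge0 x : 0 <= \big[Num.max/0]_(j in A) `|x j|.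
Proof. exact: (@bigmax_ge_id _ R I _ 0 (mem A) (fun j => `|x j|)). Qed.

End bigmax_norm.

Section lp_on_theory.
Context (R : realType) (I : finType) (A : {set I}).
Implicit Types (p q : \bar R) (x y : I -> R) (r : R).

Let sum_powR_ge0 r x : 0 <= \sum_(j in A) `|x j| `^ r.
Proof. by apply: sumr_ge0 => j _; exact: powR_ge0. Qed.

Lemma lp_on_ge0 p x : 0 <= lp_on A p x.
Proof. by case: p => [r||] //=; [exact: powR_ge0|exact: bigmax_norm_ge0]. Qed.

Lemma lp_on_powR r x : 1 <= r -> lp_on A r%:E x `^ r = \sum_(j in A) `|x j| `^ r.
Proof.
move=> r1; rewrite /= -powRrM mulVf ?powRr1//.
by rewrite gt_eqF// (lt_le_trans ltr01).
Qed.

Lemma ler_lp_on p x y : (1 <= p)%E -> (forall j, j \in A -> `|x j| <= `|y j|) ->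
  lp_on A p x <= lp_on A p y.
Proof.
case: p => [r||]; last 2 first.
- move=> _ xy; apply: bigmax_norm_le => [|j jA]; first exact: bigmax_norm_ge0.
  exact: le_trans (xy _ jA) (le_bigmax_norm _ jA).
- by [].
rewrite lee_fin => r1 xy; have r0 := lt_le_trans ltr01 r1.
rewrite ge0_ler_powR ?invr_ge0 ?nnegrE ?sum_powR_ge0 ?(ltW r0)//.
by apply: ler_sum => j /xy xyj; rewrite ge0_ler_powR ?nnegrE ?(ltW r0).
Qed.

Lemma eq_lp_on p x y : (forall j, j \in A -> `|x j| = `|y j|) ->
  lp_on A p x = lp_on A p y.
Proof.
case: p => [r||] xy; [|exact: eq_bigr|by []].
by congr (_ `^ _); apply: eq_bigr => j /xy ->.
Qed.

Lemma lp_onZ p (k : R) x : (1 <= p)%E ->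
  lp_on A p (fun j => k * x j) = `|k| * lp_on A p x.
Proof.
case: p => [r||]; [|move=> _|by []].
  rewrite lee_fin => r1 /=; have r0 := lt_le_trans ltr01 r1.
  transitivity ((`|k| `^ r * \sum_(j in A) `|x j| `^ r) `^ r^-1).
    congr (_ `^ _); rewrite mulr_sumr; apply: eq_bigr => j _.
    by rewrite normrM powRM.
  by rewrite powRM ?powR_ge0// -powRrM mulfV ?gt_eqF// powRr1.
rewrite /lp_on (big_morph (fun a => `|k| * a) (id1 := 0) (op1 := Num.max)).
- by apply: eq_bigr => j _; rewrite normrM.
- by move=> a b; rewrite maxr_pMr.
- by rewrite mulr0.
Qed.

Lemma le_lp_on p x j : (1 <= p)%E -> j \in A -> `|x j| <= lp_on A p x.
Proof.
case: p => [r||]; [|by move=> _; exact: le_bigmax_norm|by []].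
rewrite lee_fin => r1 jA /=; have r0 := lt_le_trans ltr01 r1.
rewrite -[leLHS]powRr1// -(@mulfV _ r) ?gt_eqF // powRrM.
rewrite ge0_ler_powR ?invr_ge0 ?nnegrE ?powR_ge0 ?sum_powR_ge0 ?(ltW r0)//.
by rewrite (bigD1 j)//= lerDl sumr_ge0// => i _; exact: powR_ge0.
Qed.

(** The values [0] and [-oo] of [p] have infinite inverses, so the equation excludes them and leaves
    the two endpoint cases and the finite one. *)
Lemma conjugate_exponentsP p q : (1 <= q)%E -> (p^-1 + q^-1 = 1)%E ->
  [\/ p = 1%E /\ q = +oo%E, p = +oo%E /\ q = 1%E
    | exists r s : R, [/\ p = r%:E, q = s%:E, 1 < r, 1 < s & r^-1 + s^-1 = 1]].
Proof.
case: q => [s||] //.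
  rewrite lee_fin => s1; have s0 := lt_le_trans ltr01 s1.
  rewrite (inver s) gt_eqF//; case: p => [r||] //.
  - rewrite inver; case: ifPn => [//|r0]; rewrite -EFinD => -[rs].
    move: s1; rewrite le_eqVlt => /predU1P[s1|s1].
      have /eqP : r^-1 = 0 by move: rs; rewrite -s1 invr1; lra.
      by rewrite invr_eq0 (negPf r0).
    constructor 3; exists r, s; split => //.
    have s'1 : s^-1 < 1 by rewrite invf_lt1.
    have s'0 : 0 < s^-1 by rewrite invr_gt0.
    have r'0 : 0 < r^-1 by lra.
    by rewrite -invf_lt1 -?[0 < r]invr_gt0//; lra.
  - rewrite invey add0e => -[s1']; constructor 2; split => //.
    by rewrite -[s]invrK s1' invr1.
rewrite invey adde0; case: p => [r||] _; last 2 first.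
- by rewrite invey => -[/eqP]; rewrite eq_sym oner_eq0.
- by rewrite inveNy.
- rewrite inver; case: ifPn => [//|r0] [r1]; constructor 1; split => //.
  by rewrite -[r]invrK r1 invr1.
Qed.

Lemma lp_on_normalized r x : 1 <= r -> 0 < lp_on A r%:E x ->
  \sum_(j in A) (`|x j| / lp_on A r%:E x) `^ r = 1.
Proof.
move=> r1 x0; rewrite (eq_bigr (fun j => `|x j| `^ r * (lp_on A r%:E x `^ r)^-1)).
  by rewrite -mulr_suml -lp_on_powR// mulfV// gt_eqF// powR_gt0.
move=> j _; rewrite powRM ?invr_ge0 ?lp_on_ge0//; congr (_ * _).
by rewrite -powR_inv1 ?lp_on_ge0// -powRrM mulrC powRrM powR_inv1 ?powR_ge0.
Qed.

(** For finite exponents both vectors are scaled to norm [1], Young's inequality is applied to each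
    term, and [lp_on_normalized] sums the result to [r^-1 + s^-1 = 1]. *)
Lemma lp_on_hoelder p q x y : (1 <= q)%E -> (p^-1 + q^-1 = 1)%E ->
  \sum_(j in A) `|x j| * `|y j| <= lp_on A p x * lp_on A q y.
Proof.
move=> q1 pq; case: (conjugate_exponentsP q1 pq) => [[-> ->]|[-> ->]|].
- rewrite /= invr1 powRr1// mulr_suml; apply: ler_sum => j jA.
  by rewrite powRr1// ler_wpM2l// le_bigmax_norm.
- rewrite /= invr1 powRr1// mulr_sumr; apply: ler_sum => j jA.
  by rewrite powRr1// ler_wpM2r// le_bigmax_norm.
move=> [r [s [-> -> r1 s1 rs]]].
have [r0 s0] := (lt_trans ltr01 r1, lt_trans ltr01 s1).
(* The product does not depend on [j]: either [A] is empty or one norm vanishes, which kills every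
   term, or both norms are nonzero. *)
have [xj0|/existsNP[i /not_implyP[iA xi0]]] :=
    pselect (forall j, j \in A -> lp_on A r%:E x * lp_on A s%:E y = 0).
  rewrite big1 ?mulr_ge0 ?lp_on_ge0// => j jA.
  have /eqP := xj0 _ jA; rewrite mulf_eq0 => /orP[]/eqP N0.
    have /eqP-> : x j == 0 by rewrite -normr_le0 -N0 le_lp_on// lee_fin ltW.
    by rewrite normr0 mul0r.
  have /eqP-> : y j == 0 by rewrite -normr_le0 -N0 le_lp_on// lee_fin ltW.
  by rewrite normr0 mulr0.
move/eqP: xi0; rewrite mulf_eq0 => /norP[X0 Y0].
set X := lp_on A r%:E x in X0 *; set Y := lp_on A s%:E y in Y0 *.
have X_gt0 : 0 < X by rewrite lt_def X0 lp_on_ge0.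
have Y_gt0 : 0 < Y by rewrite lt_def Y0 lp_on_ge0.
have := lp_on_normalized (ltW r1) X_gt0; have := lp_on_normalized (ltW s1) Y_gt0.
rewrite -/X -/Y; clearbody X Y => {X0 Y0} Y1 X1.
have XY_gt0 := mulr_gt0 X_gt0 Y_gt0; rewrite -[leRHS]mul1r -(ler_pdivrMr _ _ XY_gt0).
rewrite (_ : _ / _ = \sum_(j in A) (`|x j| / X) * (`|y j| / Y)); last first.
  by rewrite mulr_suml; apply: eq_bigr => j _; rewrite invfM; ring.
apply: (@le_trans _ _ (\sum_(j in A) ((`|x j| / X) `^ r / r + (`|y j| / Y) `^ s / s))).
  by apply: ler_sum => j _; apply: conjugate_powR => //; rewrite divr_ge0// ltW.
by rewrite big_split/= -!mulr_suml X1 Y1 !mul1r rs.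
Qed.

(** The maximizer is the sign vector for [p = 1], the sign at one coordinate of largest modulus for
    [p = +oo], and the signed power [r - 1] of the normalized moduli otherwise. *)
Lemma lp_on_dual p q x : (1 <= q)%E -> (p^-1 + q^-1 = 1)%E ->
  exists y : I -> R, lp_on A q y <= 1 /\ \sum_(j in A) x j * y j = lp_on A p x.
Proof.
move=> q1 pq; case: (conjugate_exponentsP q1 pq) => [[-> ->]|[-> ->]|].
- exists (fun j => Num.sg (x j)); split.
    by apply: bigmax_norm_le => // j _; rewrite normr_sg; case: eqP.
  rewrite /= invr1 powRr1//; apply: eq_bigr => j _.
  by rewrite powRr1// normrEsg mulrC.
- have [/set0Pn[i iA]|/negPn/eqP A0] := boolP (A != finset.set0); last first.
    by exists (fun=> 0); rewrite /= A0 !big_set0 powR0 ?invr_eq0 ?oner_eq0.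
  rewrite /= (bigmax_eq_arg _ i)//; case: Order.TotalTheory.arg_maxP => // k kA _.
  exists (fun j => if j == k then Num.sg (x j) else 0).
  split; rewrite (bigD1 k kA)/= big1 ?eqxx ?addr0.
  + by rewrite invr1 !powRr1// normr_sg; case: eqP.
  + by move=> j /andP[_ /negPf->]; rewrite normr0 powRr1.
  + by rewrite mulrC -normrEsg.
  + by move=> j /andP[_ /negPf->]; rewrite mulr0.
move=> [r [s [-> -> r1 s1 rs]]].
have [r0 s0] := (lt_trans ltr01 r1, lt_trans ltr01 s1).
have [X0|X0] := eqVneq (lp_on A r%:E x) 0.
  exists (fun=> 0); rewrite X0 /= !big1 ?powR0 ?invr_eq0 ?gt_eqF//.
  - by move=> j _; rewrite mulr0.
  - by move=> j _; rewrite normr0 powR0// gt_eqF.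
set X := lp_on A r%:E x in X0 *.
have X_gt0 : 0 < X by rewrite lt_def X0 lp_on_ge0.
have := lp_on_normalized (ltW r1) X_gt0; rewrite -/X; clearbody X => {X0} X1.
(* Hence the [s]-th powers of the maximizer's moduli are the normalized [r]-th powers, which sum to
   [1]. *)
have rs1 : (r - 1) * s = r.
  have s' : s^-1 = 1 - r^-1 by rewrite -rs addrC addKr.
  suff -> : r - 1 = r * s^-1 by rewrite divfK// gt_eqF.
  by rewrite s' mulrBr mulr1 mulfV// gt_eqF.
exists (fun j => Num.sg (x j) * (`|x j| / X) `^ (r - 1)); split.
  rewrite /= (eq_bigr (fun j => (`|x j| / X) `^ r)) ?X1 ?powR1// => j _.
  rewrite normrM normr_sg (ger0_norm (powR_ge0 _ _)).
  have [->|xj0] := eqVneq (x j) 0.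
    by rewrite normr0 !mul0r !powR0// gt_eqF.
  by rewrite mul1r -powRrM rs1.
transitivity (X * \sum_(j in A) (`|x j| / X) `^ r); last by rewrite X1 mulr1.
rewrite mulr_sumr; apply: eq_bigr => j _.
rewrite -(@mulr_powRB1 _ (`|x j| / X) r) ?divr_ge0 ?(ltW X_gt0)//.
rewrite !mulrA [X * _ / X]mulrAC mulfV ?gt_eqF// mul1r; congr (_ * _).
by rewrite mulrC -normrEsg.
Qed.

End lp_on_theory.

(** * Duality of the group norms *)

Lemma lp_norm_subvec (R : realType) (d : nat) (A : {set 'I_d}) (p : \bar R)
    (x : 'cV[R]_d) : lp_norm p (subvec x A) = lp_on A p (fun j => x j 0).
Proof.
case: p => [r||]; [| |by []].
  rewrite /= [in RHS]big_enum_val; congr (_ `^ _).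
  by apply: eq_bigr => k _; rewrite mxE.
rewrite /lp_norm (eq_bigl (fun k => k \in [set: 'I_#|A|]%SET)) => [|k];
  last by rewrite finset.in_setT.
apply/le_anti/andP; split; apply: bigmax_norm_le; try exact: bigmax_norm_ge0.
  by move=> k _; rewrite mxE (le_bigmax_norm (fun j => x j 0)) ?enum_valP.
move=> j jA;
have := le_bigmax_norm (fun k => subvec x A k 0) (finset.in_setT (enum_rank_in jA j)).
by rewrite mxE enum_rankK_in.
Qed.

Section group_norm_theory.
Context (R : realType) (d D : nat) (G : 'I_D -> {set 'I_d}).
Hypothesis partG : is_group_partition G.
Implicit Types (a : 'cV[R]_D) (p q s t : \bar R) (x : 'cV[R]_d).

(** In nested form the duality of [lp_on] can be applied twice, inside the groups and across
    them. *)
Lemma group_normE a p s x : (forall i, 0 < a i 0) -> group_norm G a p s x =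
  lp_on [set: 'I_D]%SET s (fun i => a i 0 * lp_on (G i) p (fun j => x j 0)).
Proof.
move=> a0; have ge0 i : 0 <= a i 0 * lp_on (G i) p (fun j => x j 0).
  by rewrite mulr_ge0 ?lp_on_ge0 ?ltW.
case: s => [r||]; [| |by []].
  rewrite /= [in RHS](eq_bigl xpredT) => [|k]; last by rewrite finset.in_setT.
  congr (_ `^ _); apply: eq_bigr => i _.
  by rewrite lp_norm_subvec ger0_norm// powRM ?lp_on_ge0 ?ltW.
rewrite /group_norm /lp_on; apply: eq_big => [k|i _]; first by rewrite finset.in_setT.
by rewrite ger0_norm// lp_norm_subvec.
Qed.

Lemma group_norm_ge0 a p s x : (forall i, 0 < a i 0) -> 0 <= group_norm G a p s x.
Proof. by move=> a0; rewrite group_normE// lp_on_ge0. Qed.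

Lemma group_normZ a p s (k : R) x : (forall i, 0 < a i 0) -> (1 <= p)%E -> (1 <= s)%E ->
  group_norm G a p s (k *: x) = `|k| * group_norm G a p s x.
Proof.
move=> a0 p1 s1; rewrite !group_normE// -lp_onZ//.
apply: eq_lp_on => i _.
rewrite (eq_lp_on _ (y := fun j => k * x j 0)) => [|j _]; last by rewrite mxE.
by rewrite lp_onZ// !normrM normr_id mulrCA.
Qed.

(** Covering and disjointness turn the partition into a function, which serves to regroup sums and
    to glue vectors given group by group. *)
Lemma group_blockP : exists b : 'I_d -> 'I_D, forall i j, (j \in G i) = (b j == i).
Proof.
case: partG => _ disjG /choice[b bG]; exists b => i j.
apply/idP/eqP => [jGi|<-//]; apply/eqP/negPn/negP => /disjG/setP/(_ j).
by rewrite finset.in_setI finset.in_set0 bG jGi.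
Qed.

Lemma sum_group (f : 'I_d -> R) : \sum_i \sum_(j in G i) f j = \sum_j f j.
Proof.
have [b bG] := group_blockP.
rewrite [RHS](partition_big b xpredT)//=; apply: eq_bigr => i _.
by apply: eq_bigl => j; rewrite bG.
Qed.

Context (a : 'cV[R]_D) (a_gt0 : forall i, 0 < a i 0) (p q s t : \bar R).
Hypotheses (q1 : (1 <= q)%E) (t1 : (1 <= t)%E).
Hypotheses (pq : (p^-1 + q^-1 = 1)%E) (st : (s^-1 + t^-1 = 1)%E).

Let N := group_norm G a p s.
Let M := group_norm G (\col_i (a i 0)^-1) q t.

Let a'_gt0 i : 0 < (\col_i (a i 0)^-1 : 'cV_D) i 0.
Proof. by rewrite mxE invr_gt0. Qed.

Lemma group_norm_hoelder (b x : 'cV[R]_d) : `|(b^T *m x) 0 0| <= N b * M x.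
Proof.
rewrite /N /M !group_normE// mxE.
apply: le_trans (ler_norm_sum _ _ _) _.
rewrite -sum_group; apply: le_trans (lp_on_hoelder _ _ _ t1 st).
rewrite [leRHS](eq_bigl xpredT) => [|i]; last by rewrite finset.in_setT.
apply: ler_sum => i _; rewrite mxE.
rewrite !ger0_norm ?mulr_ge0 ?lp_on_ge0 ?invr_ge0 ?(ltW (a_gt0 _))//.
(* The weight [a i 0] cancels against its inverse, leaving Hoelder's inequality inside one group. *)
rewrite mulrACA mulfV ?gt_eqF// mul1r.
apply: le_trans (lp_on_hoelder _ _ _ q1 pq).
by apply: ler_sum => j _; rewrite normrM mxE.
Qed.

Lemma group_norm_dual (b : 'cV[R]_d) : exists v, M v <= 1 /\ (b^T *m v) 0 0 = N b.
Proof.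
have [blk blkG] := group_blockP.
have [y yP] := choice (fun i => lp_on_dual (G i) (fun j => b j 0) q1 pq).
have [w [w1 wN]] := lp_on_dual [set: 'I_D]%SET
  (fun i => a i 0 * lp_on (G i) p (fun j => b j 0)) t1 st.
(* On group [i] the dual vector [y i] is scaled by [a i 0 * w i], where [w] is dual to the weighted
   norms of the groups of [b]; the factor [a i 0] cancels the inverse weight in [M]. *)
exists (\col_j (a (blk j) 0 * w (blk j) * y (blk j) j)); split.
  rewrite /M group_normE//; apply: le_trans w1; apply: ler_lp_on => // i _.
  rewrite (eq_lp_on _ (y := fun j => a i 0 * w i * y i j)); last first.
    by move=> j; rewrite blkG mxE => /eqP->.
  rewrite lp_onZ// mxE !normrM !(gtr0_norm (a_gt0 _)) (ger0_norm (lp_on_ge0 _ _ _)).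
  rewrite gtr0_norm ?invr_gt0// !mulrA mulVf ?gt_eqF// mul1r.
  by rewrite normr_id ler_piMr//; case: (yP i).
rewrite /N group_normE// -wN mxE -sum_group.
rewrite [RHS](eq_bigl xpredT) => [|i]; last by rewrite finset.in_setT.
apply: eq_bigr => i _; have [_ <-] := yP i.
rewrite mulr_sumr mulr_suml; apply: eq_bigr => j; rewrite blkG !mxE => /eqP->.
by ring.
Qed.

End group_norm_theory.

(** * Empirical measures and measurability *)

(** Change of variables when the image measure is known on measurable sets only, as for the
    marginals in [couplings]. *)
Lemma ge0_integral_marginal d1 d2 (T1 : measurableType d1) (T2 : measurableType d2)
    (R : realType) (phi : T1 -> T2) (mu : {measure set T1 -> \bar R})
    (nu : {measure set T2 -> \bar R}) (f : T2 -> \bar R) :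
  measurable_fun setT phi ->
  (forall A, measurable A -> pushforward mu phi A = nu A) ->
  measurable_fun setT f -> (forall x, (0 <= f x)%E) ->
  (\int[nu]_x f x = \int[mu]_x f (phi x))%E.
Proof.
move=> mphi munu mf f0.
rewrite -[RHS](@ge0_integral_pushforward _ _ _ _ _ _ mphi mu setT)//.
by apply: eq_measure_integral => A mA _; rewrite -munu.
Qed.

Section integral_empirical.
Context (R : realType) (disp : measure_display) (T : measurableType disp).
Context (n : nat) (z : 'I_n.+1 -> T).
Local Open Scope ereal_scope.
Import HBNNSimple.

Lemma ge0_integral_empirical (f : T -> \bar R) : measurable_fun setT f ->
  (forall x, 0 <= f x) ->
  \int[@empirical R disp T n z]_x f x = (n.+1%:R^-1)%R%:E * \sum_(i < n.+1) f (z i).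
Proof.
move=> mf f0.
have w_ge0 : (0 <= n.+1%:R^-1 :> R)%R by rewrite invr_ge0.
pose mu : {measure set T -> \bar R} :=
  mscale (NngNum w_ge0) (msum (fun i : nat => \d_(z (inord i))) n.+1).
transitivity (\int[mu]_x f x).
  apply: eq_measure_integral => A _ _; rewrite /mu /= /mscale /msum /empirical/=.
  by congr (_ * _); apply: eq_bigr => i _; rewrite inord_val.
rewrite /mu ge0_integral_mscale// ge0_integral_measure_sum//=; congr (_ * _).
by apply: eq_bigr => i _; rewrite integral_dirac// diracT mul1e inord_val.
Qed.

(* The integral of a nonnegative function is a supremum over simple functions,
   so this bound needs no measurability. *)
Lemma ge0_integral_empirical_le (f : T -> \bar R) : (forall x, 0 <= f x) ->
  \int[@empirical R disp T n z]_x f x <= (n.+1%:R^-1)%R%:E * \sum_(i < n.+1) f (z i).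
Proof.
move=> f0; rewrite ge0_integralTE//; apply: ge_ereal_sup => _ [h hf <-].
rewrite -integralT_nnsfun ge0_integral_empirical.
- by apply: lee_wpmul2l => //; apply: lee_sum => i _; exact: hf.
- exact/measurable_EFinP.
- by move=> x; rewrite lee_fin.
Qed.

End integral_empirical.

Lemma continuous_measurable_borel (R : realType) (T : ptopologicalType)
    (f : T -> R) : continuous f ->
  measurable_fun (setT : set (borel T)) (f : borel T -> R).
Proof.
move=> /continuousP cf; apply: (measurability _ (RGenOpens.measurableE R)).
move=> _ [_ [a [b ->] <-]]; rewrite setTI; apply: sub_sigma_algebra.
exact/cf/interval_open.
Qed.

Section data_space_measurability.
Context (R : realType) (d : nat).
Let T := borel (data_space R d).

Lemma measurable_label : measurable_fun setT (fun u : T => u.2 : R).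
Proof.
by apply: (@continuous_measurable_borel R (data_space R d)) => u; exact: cvg_snd.
Qed.

Lemma measurable_linear_form (b : 'cV[R]_d) :
  measurable_fun setT (fun u : T => (b^T *m u.1) 0 0 : R).
Proof.
have -> : (fun u : T => (b^T *m u.1) 0 0 : R) = (fun u : T => \sum_j b j 0 * u.1 j 0).
  by apply/funext => u; rewrite mxE; apply: eq_bigr => j _; rewrite mxE.
apply: measurable_sum => j; apply: measurable_funM => //.
apply: (@continuous_measurable_borel R (data_space R d)) => u.
apply: (@continuous_comp _ _ _ fst (fun M : 'cV[R]_d => M j 0)); first exact: cvg_fst.
exact: coord_continuous.
Qed.

Lemma logistic_loss_ge0 (b : 'cV[R]_d) u : 0 <= logistic_loss b u.
Proof. by rewrite ln_ge0// lerDl expR_ge0. Qed.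

Lemma measurable_logistic_loss (b : 'cV[R]_d) :
  measurable_fun setT (logistic_loss b : T -> R).
Proof.
apply: measurableT_comp; first exact: measurable_ln.
apply: measurable_funD => //; apply: measurableT_comp; first exact: measurable_expR.
apply: measurable_funM; last exact: measurable_linear_form.
apply: measurableT_comp; [exact: oppr_measurable|exact: measurable_label].
Qed.

End data_space_measurability.

(** * Upper bound on the worst-case loss *)

(** A nonnegative integral is a supremum over simple functions below the integrand, so monotonicity
    also covers the transport cost, whose measurability for the product sigma-algebra is not
    established. *)
Lemma ge0_le_integral_all d (T : measurableType d) (R : realType)
    (mu : {measure set T -> \bar R}) (f g : T -> \bar R) :
  (forall x, (0 <= f x)%E) -> (forall x, (f x <= g x)%E) ->
  (\int[mu]_x f x <= \int[mu]_x g x)%E.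
Proof.
move=> f0 fg; have g0 x := le_trans (f0 x) (fg x).
rewrite !ge0_integralTE//; apply: le_ereal_sup => _ [h hf <-].
by exists h => // x; exact: le_trans (hf x) (fg x).
Qed.

(** After exponentiation, the summands [1] and [expR a] are bounded separately, by [expR |a - b|]
    and [expR b * expR |a - b|]. *)
Lemma softplus_lipschitz (R : realType) (a b : R) :
  ln (1 + expR a) <= ln (1 + expR b) + `|a - b|.
Proof.
have e0 (x : R) : 0 < 1 + expR x by rewrite ltr_wpDr ?expR_ge0.
rewrite -ler_expR expRD !lnK ?posrE//.
have e1 : 1 <= expR `|a - b| by rewrite -expR0 ler_expR.
have e2 : expR a <= expR b * expR `|a - b|.
  by rewrite -expRD ler_expR -lerBlDl ler_norm.
by rewrite mulrDl mul1r lerD.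
Qed.

(** The part of the asymptotic linearity of the loss that the lower bound uses. *)
Lemma softplus_ge (R : realType) (a : R) : a <= ln (1 + expR a).
Proof.
by rewrite -[leLHS]expRK ler_ln ?posrE ?expR_gt0 ?ltr_wpDr ?expR_ge0// lerDr.
Qed.

(** With a general [M] in place of the group norm, the worst-case analysis rests only on the duality
    between [M] and a second function [N]. *)
Definition label_cost (R : realType) (d : nat) (M : 'cV[R]_d -> R)
    (u w : data_space R d) : \bar R :=
  if u.2 == w.2 then (M (u.1 - w.1))%:E else +oo%E.

Lemma expectation_empirical (R : realType) (d n : nat) (z : 'I_n.+1 -> data_space R d)
    (b : 'cV[R]_d) : ('E_(@empirical R _ (borel (data_space R d)) n z)[logistic_loss b] =
  (n.+1%:R^-1 * \sum_(i < n.+1) logistic_loss b (z i))%:E)%E.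
Proof.
rewrite unlock ge0_integral_empirical.
- by rewrite sumEFin.
- by apply/measurable_EFinP; exact: measurable_logistic_loss.
- by move=> u; rewrite lee_fin logistic_loss_ge0.
Qed.

Section worst_case.
Context (R : realType) (d n : nat) (X : 'I_n.+1 -> 'cV[R]_d) (Y : 'I_n.+1 -> R).
Hypothesis HY : forall i, Y i = 1 \/ Y i = -1.
Context (M : 'cV[R]_d -> R).
Let T := borel (data_space R d).
Let Pn : probability T R := @empirical R _ T n (fun i => (X i, Y i)).
Let c := label_cost M.

Definition mean_loss (b : 'cV[R]_d) : R :=
  n.+1%:R^-1 * \sum_(i < n.+1) logistic_loss b (X i, Y i).

Lemma logistic_loss_lipschitz (b : 'cV[R]_d) (u w : data_space R d) :
  u.2 = w.2 -> w.2 ^+ 2 = 1 ->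
  logistic_loss b u <= logistic_loss b w + `|(b^T *m u.1) 0 0 - (b^T *m w.1) 0 0|.
Proof.
move=> uw w1; apply: le_trans (softplus_lipschitz _ (- w.2 * (b^T *m w.1) 0 0)) _.
rewrite lerD2l uw -mulrBr normrM normrN.
suff -> : `|w.2| = 1 by rewrite mul1r.
by apply/eqP; rewrite -sqrp_eq1// real_normK ?num_real ?w1.
Qed.

Lemma worst_case_le (P : probability T R) (b : 'cV[R]_d) (K delta : R) : 0 < K ->
  (forall x, `|(b^T *m x) 0 0| <= K * M x) ->
  (ot_discrepancy c P Pn <= delta%:E)%E ->
  ('E_P[logistic_loss b] <= (mean_loss b + K * delta)%:E)%E.
Proof.
move=> K0 bM Pdelta; apply/lee_addgt0Pr => e e0.
(* The slack [e / K] becomes [e] after multiplication by the Lipschitz constant [K]. *)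
have : (ot_discrepancy c P Pn < (delta + e / K)%:E)%E.
  by apply: le_lt_trans Pdelta _; rewrite lte_fin ltrDl divr_gt0.
move=> /ereal_inf_lt[_ [pi [_ piP piPn] <-]] pi_lt.
(* [g] is a minorant of the cost that is measurable for the product
   sigma-algebra. The loss is Lipschitz with the right constant only at labels
   of modulus 1; the value +oo of [h] absorbs the other labels, which Pn does
   not charge. *)
pose h (w : T) : \bar R := if w.2 ^+ 2 == 1 then (logistic_loss b w)%:E else +oo%E.
pose g (z : T * T) : \bar R := if z.1.2 == z.2.2
  then (`|(b^T *m z.1.1) 0 0 - (b^T *m z.2.1) 0 0| / K)%:E else +oo%E.
have h0 w : (0 <= h w)%E
  by rewrite /h; case: ifP; rewrite ?leey// lee_fin logistic_loss_ge0.
have g0 z : (0 <= g z)%E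
  by rewrite /g; case: ifP; rewrite ?leey// lee_fin divr_ge0// ltW.
have mh : measurable_fun setT h.
  apply: measurable_fun_ifT => //.
    apply: measurable_fun_eqr => //; apply: measurable_funX; exact: measurable_label.
  by apply/measurable_EFinP; exact: measurable_logistic_loss.
have mg : measurable_fun setT g.
  apply: measurable_fun_ifT => //.
    apply: measurable_fun_eqr.
      exact: (measurableT_comp (@measurable_label R d) measurable_fst).
    exact: (measurableT_comp (@measurable_label R d) measurable_snd).
  apply/measurable_EFinP; apply: measurable_funM => //.
  apply: measurableT_comp => //; apply: measurable_funB.
    exact: (measurableT_comp (measurable_linear_form b) measurable_fst).
  exact: (measurableT_comp (measurable_linear_form b) measurable_snd).
have lhg z : ((logistic_loss b z.1)%:E <= h z.2 + K%:E * g z)%E.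
  have Kg0 : (0 <= K%:E * g z)%E by rewrite mule_ge0// lee_fin ltW.
  rewrite /h; case: ifPn => [/eqP w1|_];
    last by rewrite addye ?leey// gt_eqF// (lt_le_trans _ Kg0).
  rewrite /g; case: ifPn => [/eqP uw|_];
    last by rewrite gt0_muley ?lte_fin// addey// leey.
  rewrite -EFinM -EFinD lee_fin mulrCA mulfV ?gt_eqF// mulr1.
  exact: logistic_loss_lipschitz.
have gc z : (g z <= c z.1 z.2)%E.
  rewrite /g /c /label_cost; case: ifP => // _; rewrite lee_fin ler_pdivrMr// mulrC.
  by apply: le_trans (bM _); rewrite mulmxBr !mxE.
have ml : measurable_fun setT (fun u : T => (logistic_loss b u)%:E).
  by apply/measurable_EFinP; exact: measurable_logistic_loss.
rewrite unlock (ge0_integral_marginal measurable_fst piP)//; last first.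
  by move=> u; rewrite lee_fin logistic_loss_ge0.
have /le_trans -> // : (\int[pi]_z (logistic_loss b z.1)%:E <=
    \int[pi]_z (h z.2 + K%:E * g z))%E.
  by apply: ge0_le_integral_all => // z; rewrite lee_fin logistic_loss_ge0.
(* The [h] term depends on the second marginal only and integrates to [mean_loss b]; the [g] term is
   at most [K] times the cost of [pi]. *)
rewrite ge0_integralD//; first last.
- exact: measurable_funeM.
- by move=> z _; rewrite mule_ge0// lee_fin ltW.
- exact: measurableT_comp mh measurable_snd.
rewrite ge0_integralZl ?lee_fin ?(ltW K0)//.
rewrite -(ge0_integral_marginal measurable_snd piPn)// ge0_integral_empirical//.
rewrite (eq_bigr (fun i => (logistic_loss b (X i, Y i))%:E)); last first.
  by move=> i _; rewrite /h /=; case: (HY i) => ->; rewrite ?sqrrN expr1n eqxx.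
rewrite sumEFin -EFinM -/(mean_loss b) EFinD -addeA leeD2lE//.
apply: (@le_trans _ _ (K%:E * (delta + e / K)%:E)%E).
  rewrite lee_pmul2l ?lte_fin//.
  by apply: le_trans (ltW pi_lt); exact: ge0_le_integral_all.
by rewrite -EFinM -EFinD lee_fin mulrDr [X in _ + X]mulrC divfK ?gt_eqF.
Qed.

End worst_case.

(** * Perturbing one data point *)

(** Each block of [p] consecutive indices runs once through all residues. *)
Lemma sum_modn (V : nmodType) (p N : nat) (F : nat -> V) :
  \sum_(k < N * p) F (k %% p)%N = (\sum_(k < p) F k) *+ N.
Proof.
elim: N => [|N IH]; first by rewrite mulr0n big_ord0.
rewrite mulSn big_split_ord/= mulrS; congr (_ + _).
  by apply: eq_bigr => k _; rewrite modn_small.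
by rewrite -IH; apply: eq_bigr => k _; rewrite modnDl.
Qed.

Section empirical_theory.
Context (R : realType) (disp : measure_display) (T : measurableType disp).
Context (n : nat) (z : 'I_n.+1 -> T).

Lemma empiricalE (A : set T) : @empirical R disp T n z A =
  (n.+1%:R^-1 * \sum_(i < n.+1) (z i \in A)%:R)%:E.
Proof. by rewrite /empirical EFinM -sumEFin. Qed.

Lemma empirical_eq1 (A : set T) : (forall i, A (z i)) ->
  @empirical R disp T n z A = 1%E.
Proof.
move=> Az; rewrite empiricalE (eq_bigr (fun=> 1)) => [|i _]; last by rewrite mem_set.
by rewrite sumr_const card_ord mulVf.
Qed.

Lemma empirical_gt0 (A : set T) i : A (z i) -> (0 < @empirical R disp T n z A)%E.
Proof.
move=> Az; rewrite empiricalE lte_fin mulr_gt0// (bigD1 i)//= mem_set//.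
by rewrite ltr_pwDl// sumr_ge0.
Qed.

End empirical_theory.

Lemma support_empirical (R : realType) (T : ptopologicalType) (n : nat)
    (z : 'I_n.+1 -> borel T) i : support (@empirical R _ (borel T) n z) (z i).
Proof. by move=> V _ Vz; exact: empirical_gt0 Vz. Qed.

(* Pn is also the empirical measure of the data repeated N.+1 times; moving a
   single copy of the first point transports the mass m.+1%:R^-1, small when N
   is large. *)
Section perturbation.
Context (R : realType) (d n : nat) (X : 'I_n.+1 -> 'cV[R]_d) (Y : 'I_n.+1 -> R).
Hypothesis HY : forall i, Y i = 1 \/ Y i = -1.
Context (M : 'cV[R]_d -> R).
Let T := borel (data_space R d).
Let Pn : probability T R := @empirical R _ T n (fun i => (X i, Y i)).
Let c := label_cost M.
Hypothesis M_ge0 : forall x, 0 <= M x.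
Hypothesis MZ : forall k x, M (k *: x) = `|k| * M x.

Context (N : nat).
(** Chosen so that [m.+1] is convertible to [N.+1 * n.+1], the number of repeated data points. *)
Let m := (n + N * n.+1)%N.
Let w (k : 'I_m.+1) : T := (X (inord (k %% n.+1)), Y (inord (k %% n.+1))).

Lemma sum_repeated (f : T -> R) :
  m.+1%:R^-1 * \sum_k f (w k) = n.+1%:R^-1 * \sum_i f (X i, Y i).
Proof.
rewrite (@sum_modn R n.+1 N.+1 (fun k => f (X (inord k), Y (inord k)))).
rewrite (eq_bigr (fun i => f (X i, Y i))) => [|i _]; last by rewrite inord_val.
rewrite -[X in _ * X]mulr_natl mulrA; congr (_ * _).
by rewrite -[m.+1]/(N.+1 * n.+1)%N natrM invfM mulrAC mulVf ?mul1r.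
Qed.

Context (delta : R) (delta_gt0 : 0 < delta) (v : 'cV[R]_d) (Mv : M v <= 1).
(** The moved copy has mass [m.+1%:R^-1], so a displacement of length at most [k0] costs at most
    [delta]. *)
Let k0 := delta * m.+1%:R.
(** The label in the displacement cancels the one in the loss: the exponent [- y * (b^T *m x) 0 0]
    grows by [k0 * (b^T *m v) 0 0] for either label. *)
Let u (k : 'I_m.+1) : T :=
  if k == ord0 then ((w k).1 - (k0 * (w k).2) *: v, (w k).2) else w k.
Let P : probability T R := @empirical R _ T m u.

Let Yw k : (w k).2 = 1 \/ (w k).2 = -1. Proof. exact: HY. Qed.

Lemma perturbation_cost : (ot_discrepancy c P Pn <= delta%:E)%E.
Proof.
(* Points with the same index are matched, so only index [ord0] contributes to the cost. *)
pose pi : probability (T * T)%type R :=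
  @empirical R _ (T * T)%type m (fun k => (u k, w k)).
have pi_coupling : couplings P Pn pi.
  split.
  - apply: empirical_eq1 => k; split; first exact: support_empirical.
    exact: (@support_empirical R (data_space R d) n (fun i => (X i, Y i))).
  - by move=> A _; rewrite /pushforward /P /pi /= !empiricalE.
  - move=> A _; rewrite /pushforward /Pn /pi /= !empiricalE.
    by congr (_%:E); rewrite -(sum_repeated (fun x => (x \in A)%:R)).
apply: (@le_trans _ _ (\int[pi]_z c z.1 z.2)%E).
  by apply: ereal_inf_lbound; exists pi.
have c0 (z : T * T) : (0 <= c z.1 z.2)%E
  by rewrite /c /label_cost; case: ifP; rewrite ?leey ?lee_fin.
have /le_trans -> // : (\int[pi]_z c z.1 z.2 <=
    (m.+1%:R^-1)%:E * \sum_k c (u k) (w k))%E.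
  by apply: ge0_integral_empirical_le => z; exact: c0.
have M0 : M 0 = 0 by rewrite -(scale0r v) MZ normr0 mul0r.
rewrite (bigD1 ord0)//= big1 => [|k k0']; last first.
  by rewrite /c /label_cost /u (negPf k0') eqxx subrr M0.
rewrite adde0 /c /label_cost /u eqxx/= eqxx -EFinM lee_fin.
rewrite addrAC subrr add0r -scaleNr MZ ler_pdivrMl//.
rewrite normrN normrM (_ : `|Y _| = 1);
  last by case: (HY (inord (0 %% n.+1))) => ->; rewrite ?normrN normr1.
rewrite mulr1 ger0_norm; last by rewrite mulr_ge0// ltW.
by rewrite [leRHS]mulrC -/k0 ler_piMr// mulr_ge0// ltW.
Qed.

(** Only the loss of the moved copy changes, and [softplus_ge] bounds its new value below by the
    exponent. The mass turns the gain of [k0] into [delta]; the subtracted term is a constant times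
    [m.+1%:R^-1]. *)
Lemma perturbation_loss (b : 'cV[R]_d) :
  (((mean_loss X Y b + delta * (b^T *m v) 0 0) -
    m.+1%:R^-1 * (Y ord0 * (b^T *m X ord0) 0 0 + logistic_loss b (X ord0, Y ord0)))%:E
   <= 'E_P[logistic_loss b])%E.
Proof.
rewrite expectation_empirical lee_fin.
have -> : m.+1%:R^-1 * \sum_k logistic_loss b (u k) = mean_loss X Y b +
    m.+1%:R^-1 * (logistic_loss b (u ord0) - logistic_loss b (w ord0)).
  rewrite /mean_loss -(sum_repeated (logistic_loss b)) -mulrDr; congr (_ * _).
  rewrite (bigD1 ord0)//= [in RHS](bigD1 ord0)//= addrAC addrCA subrr addr0.
  by congr (_ + _); apply: eq_bigr => k /negPf k0'; rewrite /u k0'.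
rewrite -addrA lerD2l.
have -> : delta = m.+1%:R^-1 * k0 by rewrite mulrCA mulVf ?mulr1.
rewrite -mulrA -mulrBr ler_pM2l ?invr_gt0// opprD addrA.
have idx0 : inord (0 %% n.+1) = ord0 :> 'I_n.+1
  by rewrite mod0n; apply: val_inj; rewrite /= inordK.
rewrite /u eqxx /w /= idx0 lerD2r.
apply: le_trans (softplus_ge _) => /=.
rewrite mulmxBr -scalemxAr !mxE.
set bX := (\sum_j _); set bv := (\sum_j _).
by case: (HY ord0) => ->; lra.
Qed.

End perturbation.

(** * Existence of minimizers *)

Section l1_lipschitz.
Context (R : realType) (d : nat).
Implicit Types (b x : 'cV[R]_d).

Definition l1_dist b b' : R := \sum_j `|b j 0 - b' j 0|.

Lemma l1_dist_ge0 b b' : 0 <= l1_dist b b'.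
Proof. by rewrite sumr_ge0. Qed.

Lemma dot_l1_dist b b' x :
  `|(b^T *m x) 0 0 - (b'^T *m x) 0 0| <= l1_dist b b' * \sum_j `|x j 0|.
Proof.
rewrite !mxE -sumrB mulr_suml; apply: le_trans (ler_norm_sum _ _ _) _.
apply: ler_sum => j _; rewrite !mxE -mulrBl normrM ler_wpM2l//.
by rewrite (bigD1 j)//= lerDl sumr_ge0.
Qed.

(** The transpose moves [f] to row vectors, where compactness of boxes is applied below. *)
Lemma l1_lipschitz_continuous (f : 'cV[R]_d -> R) (L : R) : 0 <= L ->
  (forall b b', f b <= f b' + l1_dist b b' * L) ->
  continuous (fun v : 'rV[R]_d => f v^T).
Proof.
move=> L0 fL v; apply/(@cvgrPdist_le _ _ _ (nbhs v)) => e e0.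
(* Coordinatewise distance [e'] gives [l1_dist] at most [d%:R * e']; the [+ 1] keeps the denominator
   positive. *)
pose e' := e / (d%:R * L + 1).
have dL0 : 0 < d%:R * L + 1 by rewrite ltr_wpDl// mulr_ge0.
have e'0 : 0 < e' by rewrite divr_gt0.
near=> w.
have [_ vw] : ball v e' w by near: w; exact: nbhsx_ballx.
have dist_le b b' : (forall j, `|b j 0 - b' j 0| <= e') -> f b - f b' <= e.
  move=> bb'; rewrite lerBlDl; apply: le_trans (fL b b') _; rewrite lerD2l.
  apply: (@le_trans _ _ (\sum_(j < d) e' * L)).
    by rewrite mulr_suml; apply: ler_sum => j _; rewrite ler_wpM2r.
  rewrite sumr_const card_ord -mulr_natl mulrCA /e' mulrAC ler_pdivrMr//.
  by rewrite ler_wpM2l ?(ltW e0)// lerDl.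
rewrite ler_norml lerNl opprB; apply/andP; split; apply: dist_le => j; rewrite !mxE.
  by rewrite distrC; exact/ltW/vw.
exact/ltW/vw.
Unshelve. all: by end_near. Qed.

(** The minimum over the box of radius [C] is global: the box contains [0], and every point outside
    it has a value above [f 0]. *)
Lemma l1_lipschitz_coercive_min (f : 'cV[R]_d -> R) (L C : R) : 0 <= L -> 0 <= C ->
  (forall b b', f b <= f b' + l1_dist b b' * L) ->
  (forall b, f b <= f 0 -> forall j, `|b j 0| <= C) ->
  exists b0, forall b, f b0 <= f b.
Proof.
move=> L0 C0 fL fC.
pose box := [set v : 'rV[R]_d | forall j, `[- C, C]%classic (v ord0 j)].
have box0 : box 0 by move=> j; rewrite /= mxE in_itv/= oppr_le0 C0.
have cbox : compact box
  by apply: (@rV_compact R d (fun=> `[- C, C]%classic)) => j; exact: segment_compact.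
have box_nonempty : box !=set0 by exists 0.
have [|v _ vmin] := @compact_EVT_min _ R (fun v => f v^T) box box_nonempty cbox.
  by apply: continuous_subspaceT; exact: l1_lipschitz_continuous L0 fL.
exists v^T => b; have [fb|/ltW fb] := leP (f b) (f 0).
  rewrite -[b]trmxK; apply: vmin; rewrite inE => j /=.
  by rewrite in_itv/= mxE -ler_norml fC.
by apply: le_trans fb; have := vmin 0; rewrite trmx0; apply; rewrite inE.
Qed.

End l1_lipschitz.

(** * Worst-case loss and minimizers for an abstract dual pair [N], [M] *)

Section dual_norms.
Context (R : realType) (d n : nat) (X : 'I_n.+1 -> 'cV[R]_d) (Y : 'I_n.+1 -> R).
Hypothesis HY : forall i, Y i = 1 \/ Y i = -1.
Context (N M : 'cV[R]_d -> R).
Hypothesis N_ge0 : forall b, 0 <= N b.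
Hypothesis M_ge0 : forall x, 0 <= M x.
Hypothesis MZ : forall k x, M (k *: x) = `|k| * M x.
Hypothesis hoelder : forall b x, `|(b^T *m x) 0 0| <= N b * M x.
Hypothesis dual : forall b, exists v, M v <= 1 /\ (b^T *m v) 0 0 = N b.
Context (delta : R) (delta_gt0 : 0 < delta).
Let Pn : probability (borel (data_space R d)) R :=
  @empirical R _ (borel (data_space R d)) n (fun i => (X i, Y i)).

Lemma worst_case_loss b :
  ereal_sup [set ('E_P[logistic_loss b])%E
            | P in [set P : probability (borel (data_space R d)) R
                   | (ot_discrepancy (label_cost M) P Pn <= delta%:E)%E]] =
  (mean_loss X Y b + delta * N b)%:E.
Proof.
apply/le_anti/andP; split.
  apply: ge_ereal_sup => _ [P Pdelta <-]; apply/lee_addgt0Pr => e e0.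
  (* [N b] may vanish, while [worst_case_le] asks for a positive constant; the surplus [e / delta]
     costs [e] in the end. *)
  have K0 : 0 < N b + e / delta by rewrite ltr_wpDl// divr_gt0.
  have bM x : `|(b^T *m x) 0 0| <= (N b + e / delta) * M x.
    by apply: le_trans (hoelder b x) _; rewrite ler_wpM2r// lerDl divr_ge0 ?ltW.
  apply: le_trans (worst_case_le HY K0 bM Pdelta) _.
  by rewrite -EFinD lee_fin mulrDl divfK ?gt_eqF// addrA [N b * _]mulrC.
have [v [Mv bv]] := dual b.
apply/lee_addgt0Pr => e e0.
pose B := Y ord0 * (b^T *m X ord0) 0 0 + logistic_loss b (X ord0, Y ord0).
(* Repeating the data more than [|B| / e] times brings the remainder of [perturbation_loss] down to
   at most [e]. *)
pose K := Num.bound (`|B| / e).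
have Ploss := perturbation_loss X HY K delta v b.
have Pcost := perturbation_cost X HY M_ge0 MZ K delta_gt0 Mv.
rewrite bv -/B in Ploss.
set S := ereal_sup _.
have LS : ((mean_loss X Y b + delta * N b - (n + K * n.+1).+1%:R^-1 * B)%:E <= S)%E.
  by apply: le_trans Ploss (ereal_sup_ubound _); eexists; [exact: Pcost|].
apply: le_trans (leeD2r _ LS).
rewrite -EFinD lee_fin -addrA lerDl addrC subr_ge0 ler_pdivrMl//.
apply: le_trans (ler_norm _) _; rewrite -ler_pdivrMr//.
apply/ltW/(lt_le_trans (archi_boundP _)); first by rewrite divr_ge0// ltW.
by rewrite ler_nat -/K; nia.
Qed.

(** Lipschitz continuity and coercivity of the penalty [N] are both drawn from its duality with [M],
    tested on the unit vectors [e j]. *)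
Lemma regularized_loss_min :
  exists b0, forall b, mean_loss X Y b0 + delta * N b0 <= mean_loss X Y b + delta * N b.
Proof.
pose e j : 'cV[R]_d := delta_mx j 0.
have dotE (x : 'cV[R]_d) j : (x^T *m e j) 0 0 = x j 0.
  rewrite mxE (bigD1 j)//= big1 ?addr0; first by rewrite !mxE !eqxx mulr1.
  by move=> k /negPf kj; rewrite !mxE kj mulr0.
have mean_ge0 b : 0 <= mean_loss X Y b.
  by rewrite mulr_ge0// sumr_ge0// => i _; exact: logistic_loss_ge0.
pose f b := mean_loss X Y b + delta * N b.
pose S (x : 'cV[R]_d) := \sum_j `|x j 0|.
pose LN := \sum_j N (e j).
pose LX := n.+1%:R^-1 * \sum_i S (X i).
have S_ge0 x : 0 <= S x by rewrite sumr_ge0.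
have f0_ge0 : 0 <= f 0 by rewrite addr_ge0// mulr_ge0// ltW.
apply: (@l1_lipschitz_coercive_min _ _ f (LX + delta * LN) (f 0 / delta * \sum_j M (e j))).
- by rewrite addr_ge0// mulr_ge0 ?sumr_ge0// ltW.
- by rewrite mulr_ge0 ?sumr_ge0// divr_ge0// ltW.
- move=> b b'.
  have mean_le : mean_loss X Y b <= mean_loss X Y b' + l1_dist b b' * LX.
    rewrite /mean_loss /LX mulrCA -mulrDr ler_wpM2l// mulr_sumr -big_split/=.
    apply: ler_sum => i _; apply: le_trans (softplus_lipschitz _ (- Y i * (b'^T *m X i) 0 0)) _.
    rewrite lerD2l -mulrBr normrM normrN (_ : `|Y i| = 1) ?mul1r ?dot_l1_dist//.
    by case: (HY i) => ->; rewrite ?normrN normr1.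
  have N_le : N b <= N b' + l1_dist b b' * LN.
    (* With [v] dual to [b], the pairing of [b'] with [v] is at most [N b'], and the rest is
       controlled by the coordinates of [v], each at most [N (e j)] in modulus. *)
    have [v [Mv <-]] := dual b.
    rewrite -[leLHS](subrK ((b'^T *m v) 0 0)) addrC; apply: lerD.
      apply: le_trans (ler_norm _) _; apply: le_trans (hoelder _ _) _.
      by rewrite ler_piMr.
    apply: le_trans (ler_norm _) _; apply: le_trans (dot_l1_dist _ _ _) _.
    rewrite ler_wpM2l ?l1_dist_ge0//; apply: ler_sum => j _.
    have := hoelder (e j) v; rewrite -[(e j)^T *m v]trmxK trmx_mul trmxK mxE dotE.
    by move/le_trans; apply; rewrite ler_piMr.
  rewrite /f [leRHS](_ : _ = (mean_loss X Y b' + l1_dist b b' * LX) +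
    delta * (N b' + l1_dist b b' * LN)); last by ring.
  by rewrite lerD// ler_pM2l.
(* The mean loss is nonnegative, so [f b <= f 0] gives [N b <= f 0 / delta]; pairing [b] with [e j]
   then bounds its coordinate [j]. *)
move=> b fb j; rewrite -dotE; apply: le_trans (hoelder _ _) _.
apply: ler_pM => //.
  rewrite ler_pdivlMr// mulrC; apply: le_trans fb.
  by rewrite lerDr.
by rewrite (bigD1 j)//= lerDl sumr_ge0.
Qed.

End dual_norms.

(** * Application to the group norms *)

Theorem theorem2 (R : realType) (d D n : nat)
    (X : 'I_n.+1 -> 'cV[R]_d) (Y : 'I_n.+1 -> R)
    (HY : forall i, Y i = 1 \/ Y i = -1)
    (G : 'I_D -> {set 'I_d}) (HG : is_group_partition G)
    (alpha : 'cV[R]_D) (Halpha : forall i, 0 < alpha i 0)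
    (q t p s : \bar R) (Hq : (1 <= q)%E) (Ht : (1 <= t)%E)
    (Hpq : (p^-1 + q^-1 = 1)%E) (Hst : (s^-1 + t^-1 = 1)%E)
    (delta : R) (Hdelta : 0 < delta) :
  let Pn : probability (borel (data_space R d)) R :=
    @empirical R _ (borel (data_space R d)) n (fun i => (X i, Y i)) in
  let c := transport_cost G alpha q t in
  exists m : \bar R,
    is_min (range (fun beta : 'cV[R]_d =>
      ereal_sup [set ('E_P[logistic_loss beta])%E
                | P in [set P : probability (borel (data_space R d)) R
                       | (ot_discrepancy c P Pn <= delta%:E)%E]])) m /\
    is_min (range (fun beta : 'cV[R]_d =>
      ('E_Pn[logistic_loss beta] + (delta * group_norm G alpha p s beta)%:E)%E)) m.
Proof.
move=> Pn c.
have Halpha' i : 0 < (\col_i (alpha i 0)^-1 : 'cV[R]_D) i 0 by rewrite mxE invr_gt0.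
have N_ge0 b := group_norm_ge0 G p s b Halpha.
have M_ge0 x := group_norm_ge0 G q t x Halpha'.
have MZ k x := group_normZ G k x Halpha' Hq Ht.
have hoelder b x := group_norm_hoelder HG Halpha Hq Ht Hpq Hst b x.
have dual b := group_norm_dual HG Halpha Hq Ht Hpq Hst b.
have worst b := worst_case_loss X HY N_ge0 M_ge0 MZ hoelder dual Hdelta b.
have regularized b : ('E_Pn[logistic_loss b] + (delta * group_norm G alpha p s b)%:E =
    (mean_loss X Y b + delta * group_norm G alpha p s b)%:E)%E.
  by rewrite expectation_empirical EFinD.
have [b0 b0_min] := regularized_loss_min X HY N_ge0 M_ge0 hoelder dual Hdelta.
(* By [worst] and [regularized] both objectives equal the same real function of [b], so [b0]
   minimizes both with this common value. *)
exists (mean_loss X Y b0 + delta * group_norm G alpha p s b0)%:E.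
split; split.
- by exists b0 => //; exact: worst.
- by move=> _ [b _ <-]; rewrite [leRHS]worst lee_fin.
- by exists b0.
- by move=> _ [b _ <-]; rewrite regularized lee_fin.
Qed.
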